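(* Let $\tau_1,\tau_2,\ldots$ be i.i.d. positive random variables with $\mathbb{E}\tau_1^2<\infty$ and distribution $B$, and let $\widehat{B}(s):=\int_0^\infty e^{-sx}\,dB(x)$. Let $\mu>0$. Let $\pi=\{\pi_i\}_{i\ge1}$ be the stationary distribution of the Markov chain on $\{1,2,\ldots\}$ with transition probabilities $$P_{ij}=\mathbb{P}\left(S_{j-1}<\max(\sigma_1,\ldots,\sigma_i)\le S_j\right),\qquad i,j=1,2,\ldots,$$ where $S_0=0$, $S_j=\tau_1+\cdots+\tau_j$, and the $\sigma_m$ are i.i.d. exponential with rate $\mu$, independent of $\{\tau_m\}$. Let $\phi(z)=\sum_{i\ge1}\pi_iz^i$ be the probability generating function of $\pi$ and let $\phi^{(m)}(1)=\sum_{n\ge1}n(n-1)\cdots(n-m+1)\pi_n$ denote its descending factorial moments. Define $$x_m:=\frac{\phi^{(m)}(1)}{m!},\qquad a_{mk}:=\frac{\widehat{B}(k\mu)^{m-1}}{(1-\widehat{B}(k\mu))^m},\qquad k,m=1,2,\ldots.$$ Then the sequence $\{x_m\}$, $m=1,2,\ldots$, satisfies the infinite linear system $$x_m=\sum_{k=1}^\infty x_k(-1)^{k-1}a_{mk},\qquad m=1,2,\ldots.$$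
   Context: The chain is the number of customers served in successive stages of the synchronized gated $GI/M/\infty$ system: customers arrive according to a renewal process with interarrival times $\tau_m$; customers admitted at a gate opening are served in parallel with i.i.d. exponential($\mu$) service times; when all have finished, the gate stays closed until the next arrival epoch, when all customers who arrived since the last opening (including the one just arriving) are admitted. The chain is irreducible, and it is positive recurrent when $\mathbb{E}\tau_1^2<\infty$, so $\pi$ exists and is unique.
   Formalization: The m=1 series diverges when B̂(μ)≥1/2 (e.g. exponential τ with rate ≥ μ), so each equation is asserted only when its series converges; all moments are shown finite, and all the series converge exactly when B̂(μ)<1/2. *)

(* Defs.v *)
(* MathComp / MathComp-Analysis *)
From HB Require Import structures.
From mathcomp Require Export all_boot all_order all_algebra.
From mathcomp Require Export all_classical all_reals all_analysis.
Set Implicit Arguments.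
Unset Strict Implicit.
Unset Printing Implicit Defensive.
Import Order.TTheory GRing.Theory Num.Theory.
Import numFieldNormedType.Exports.
Local Open Scope classical_set_scope.
Local Open Scope ring_scope.

Definition mutually_independent (R : realType) (d : measure_display)
    (T : measurableType d) (P : probability T R) (I : eqType)
    (X : I -> {RV P >-> R}) : Prop :=
  forall (s : seq I) (E : I -> set R), uniq s ->
    (forall i, measurable (E i)) ->
    P (\bigcap_(i in [set` s]) (X i @^-1` E i)) =
    (\prod_(i <- s) P (X i @^-1` E i))%E.

(* Interarrival and service times are numbered from 0: [tau k] is the
   (k+1)-st interarrival time and [sigma k] the (k+1)-st service time. *)
Section gated_chain.
Context (R : realType) (d : measure_display) (T : measurableType d)
  (P : probability T R).
Variables tau sigma : nat -> {RV P >-> R}.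

Definition arrival_epoch (j : nat) (w : T) : R := \sum_(k < j) tau k w.

(* Starting the maximum at [sigma 0] makes it the maximum of the first i
   service times for every i >= 1, whatever their signs. *)
Definition stage_length (i : nat) (w : T) : R :=
  \big[Num.max/sigma 0%N w]_(k < i) sigma k w.

(* Only used for i, j >= 1, the states of the chain. *)
Definition gated_transition (i j : nat) : \bar R :=
  P [set w | arrival_epoch j.-1 w < stage_length i w <= arrival_epoch j w].

End gated_chain.

(* The states are the positive integers; the values of [p], [Q] at 0 are
   irrelevant. *)
Definition is_stationary (R : realType) (Q : nat -> nat -> \bar R)
    (p : nat -> R) : Prop :=
  [/\ forall i, (0 < i)%N -> 0 <= p i,
      (\sum_(1 <= i <oo) (p i)%:E = 1)%E &
      forall j, (0 < j)%N ->
        (\sum_(1 <= i <oo) ((p i)%:E * Q i j) = (p j)%:E)%E].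

(* [n ^_ m] is the falling factorial n(n-1)...(n-m+1). *)
Definition desc_factorial_moment (R : realType) (p : nat -> R) (m : nat) :
    \bar R :=
  (\sum_(1 <= n <oo) ((n ^_ m)%:R * p n)%:E)%E.

Definition scaled_moment (R : realType) (p : nat -> R) (m : nat) : R :=
  fine (desc_factorial_moment p m) / (m`!)%:R.

Definition laplace_stieltjes (R : realType)
    (B : probability (measurableTypeR R) R) (s : R) : R :=
  \int[B]_(x in `[0, +oo[) expR (- s * x).

Definition system_coef (R : realType) (B : probability (measurableTypeR R) R)
    (mu : R) (m k : nat) : R :=
  laplace_stieltjes B (k%:R * mu) ^+ m.-1
    / (1 - laplace_stieltjes B (k%:R * mu)) ^+ m.

(* The n-th partial sum of the right-hand side of the m-th equation. Since
   x_k >= b^(k-1)/(1-b)^k with b = [laplace_stieltjes B mu], the terms for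
   m = 1 do not tend to 0 when b >= 1/2: convergence cannot be taken for
   granted. *)
Definition system_partial_sum (R : realType) (x : nat -> R)
    (a : nat -> nat -> R) (m n : nat) : R :=
  \sum_(1 <= k < n.+1) x k * (-1) ^+ k.-1 * a m k.

(* Main.v *)
(* Let t_ij = P(M_i > S_j), where M_i is the maximum of i service times, and let
   T_j = sum_i pi_i t_ij be the tails of pi.  Conditioning on the arrivals and
   using the memoryless property, t_ij satisfies Bonferroni's inequalities with
   terms (-1)^(k-1) C(i,k) b_k^j, where b_k is the transform of B at k mu.
   Hence t_ij <= i b_1^j, from which stationarity yields a finite mean, and then
   b_1^j <= T_j <= x_1 b_1^j, so that all factorial moments are finite.
   Summation by parts gives x_m = sum_j C(j,m-1) T_j, and
   sum_j C(j,m-1) b_k^j = a_mk; summing Bonferroni's inequalities over i and j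
   shows that the partial sums of sum_k x_k (-1)^(k-1) a_mk lie alternately above
   and below x_m, so they can only converge to x_m, absolutely or not.
   The bounds on T_j also give
   b_1^(k-1)/(1-b_1)^k <= x_k <= x_1 b_1^(k-1)/(1-b_1)^k, which decides
   convergence: geometric if b_1 < 1/2, while for m = 1 the terms stay away from
   0 if b_1 >= 1/2. *)
Require Import Defs.
From mathcomp Require Import measurable_realfun ring lra.
Set Implicit Arguments.
Unset Strict Implicit.
Unset Printing Implicit Defensive.
Import Order.TTheory GRing.Theory Num.Theory.
Import numFieldNormedType.Exports.
Local Open Scope classical_set_scope.
Local Open Scope ring_scope.

(** * Convergent real series with a given starting index *)

Section series_from.
Context {R : realType}.
Implicit Types (u v : nat -> R) (N n : nat) (l c : R).

(** The start [N] is a parameter because sums over states begin at 1 and sums over arrivals at 0.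
    Convergence need not be absolute. *)
Definition sums_to N u l := \sum_(N <= i < n) u i @[n --> \oo] --> l.

Lemma eq_sums_to N u v l : (forall i, (N <= i)%N -> u i = v i) ->
  sums_to N u l -> sums_to N v l.
Proof.
move=> uv; rewrite /sums_to; apply: cvg_trans; apply: near_eq_cvg.
by near=> n; apply: eq_big_nat => i /andP[Ni _]; rewrite uv.
Unshelve. all: by end_near. Qed.

Lemma sums_to_unique N u l l' : sums_to N u l -> sums_to N u l' -> l = l'.
Proof. by move=> ul ul'; apply: (cvg_unique _ ul ul'). Qed.

Lemma sums_to0 N : sums_to N (fun=> 0) 0.
Proof.
rewrite /sums_to; under eq_fun do rewrite big1 //.
exact: cvg_cst.
Qed.

Lemma sums_toD N u v l l' : sums_to N u l -> sums_to N v l' ->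
  sums_to N (fun i => u i + v i) (l + l').
Proof.
move=> ul vl; rewrite /sums_to; under eq_fun do rewrite big_split.
exact: cvgD ul vl.
Qed.

Lemma sums_toZ N u l c : sums_to N u l -> sums_to N (fun i => c * u i) (c * l).
Proof.
move=> ul; rewrite /sums_to; under eq_fun do rewrite -mulr_sumr.
exact: cvgM (cvg_cst _) ul.
Qed.

Lemma sums_to_sum N (I : eqType) (s : seq I) (u : I -> nat -> R) (l : I -> R) :
  (forall k, k \in s -> sums_to N (u k) (l k)) ->
  sums_to N (fun i => \sum_(k <- s) u k i) (\sum_(k <- s) l k).
Proof.
elim: s => [|k s IH] us.
  rewrite big_nil; apply: eq_sums_to (sums_to0 N) => i _.
  by rewrite big_nil.
rewrite big_cons; apply: (@eq_sums_to _ (fun i => u k i + \sum_(k' <- s) u k' i)).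
  by move=> i _; rewrite big_cons.
apply: sums_toD; first by apply: us; rewrite mem_head.
by apply: IH => k' k's; apply: us; rewrite in_cons k's orbT.
Qed.

Lemma le_sums_to N u v l l' : sums_to N u l -> sums_to N v l' ->
  (forall i, (N <= i)%N -> u i <= v i) -> l <= l'.
Proof.
move=> ul vl uv; apply: (ler_cvg_to ul vl); near=> n.
by apply: ler_sum_nat => i /andP[Ni _]; exact: uv.
Unshelve. all: by end_near. Qed.

Lemma nondecreasing_partial_sum N u : (forall i, (N <= i)%N -> 0 <= u i) ->
  {homo (fun n => \sum_(N <= i < n) u i) : n m / (n <= m)%N >-> n <= m}.
Proof.
move=> u0 n m nm; have [Nn|nN] := leqP N n.
  rewrite [leRHS](big_cat_nat Nn nm)/= lerDl big_nat_cond; apply: sumr_ge0.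
  by move=> i /andP[/andP[ni _] _]; apply: u0; exact: leq_trans ni.
rewrite [leLHS]big_geq 1?ltnW// big_nat_cond; apply: sumr_ge0 => i.
by move=> /andP[/andP[Ni _] _]; exact: u0.
Qed.

Lemma sums_to_bounded N u M : (forall i, (N <= i)%N -> 0 <= u i) ->
  (forall n, \sum_(N <= i < n) u i <= M) -> exists l, sums_to N u l.
Proof.
move=> u0 uM; exists (limn (fun n => \sum_(N <= i < n) u i)).
apply: nondecreasing_is_cvgn; first exact: nondecreasing_partial_sum.
by exists M => _ [n _ <-].
Qed.

Lemma partial_sum_le N u l n : (forall i, (N <= i)%N -> 0 <= u i) ->
  sums_to N u l -> \sum_(N <= i < n) u i <= l.
Proof.
move=> u0 ul; rewrite -(cvg_lim _ ul)//.
apply: nondecreasing_cvgn_le; first exact: nondecreasing_partial_sum.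
by apply/cvg_ex; exists l.
Qed.

Lemma sums_to_le N u l M : sums_to N u l ->
  (forall n, (N <= n)%N -> \sum_(N <= i < n) u i <= M) -> l <= M.
Proof.
move=> ul uM; apply: (ler_cvg_to ul (cvg_cst M)).
by exists N => // n /= Nn; exact: uM.
Qed.

Lemma sums_to_cvg0 N u l : sums_to N u l -> u n @[n --> \oo] --> 0.
Proof.
move=> ul; have uc : cvgn (series u).
  by rewrite -(is_cvg_series_restrict N); apply/cvg_ex; exists l.
exact: cvg_series_cvg_0.
Qed.

End series_from.

(** * Summation by parts and the negative binomial series *)

Section negative_binomial.
Context {R : realType}.

(** Abel summation driven by Pascal's rule. The boundary term stays, since its vanishing in the
    limit needs decay of [T]. *)
Lemma sum_bin_by_parts (T : nat -> R) (m N : nat) :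
  \sum_(1 <= n < N.+1) 'C(n, m.+1)%:R * (T n.-1 - T n) =
  \sum_(0 <= j < N) 'C(j, m)%:R * T j - 'C(N, m.+1)%:R * T N.
Proof.
elim: N => [|N IH]; first by rewrite !big_geq// bin0n mul0r subr0.
rewrite big_nat_recr//= IH big_nat_recr//= binS natrD; ring.
Qed.

(** For [c] the transform of [B] at $k\mu$ the sum is the coefficient $a_{m+1,k}$. By induction on
    [m]: summation by parts gives $(1-c)S_{m+1} = cS_m$ in the limit. *)
Lemma negative_binomial (c : R) (m : nat) : 0 <= c < 1 ->
  sums_to 0 (fun j => 'C(j, m)%:R * c ^+ j) (c ^+ m / (1 - c) ^+ m.+1).
Proof.
move=> /andP[c0 c1]; have d0 : 0 < 1 - c by rewrite subr_gt0.
elim: m => [|m IH].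
  rewrite expr0 expr1; have := @cvg_geometric_series R 1 c.
  rewrite ger0_norm// => /(_ c1).
  apply: cvg_trans; apply: near_eq_cvg; near=> n.
  by rewrite /series/=; apply: eq_bigr => i _; rewrite bin0 !mul1r.
have t0 k j : (0 <= j)%N -> 0 <= 'C(j, k)%:R * c ^+ j :> R.
  by move=> _; rewrite mulr_ge0// exprn_ge0.
(* Here $(1-c)c^j = c(c^{j-1}-c^j)$ for [j >= 1], and the term [j = 0] vanishes. *)
have key N : (1 - c) * \sum_(0 <= j < N.+1) 'C(j, m.+1)%:R * c ^+ j =
    c * (\sum_(0 <= j < N) 'C(j, m)%:R * c ^+ j - 'C(N, m.+1)%:R * c ^+ N).
  rewrite -(sum_bin_by_parts (fun j => c ^+ j)) big_ltn// bin0n/= mul0r add0r.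
  rewrite !mulr_sumr; apply: eq_big_nat => -[//|i] _ /=.
  by rewrite exprS; ring.
(* Convergence comes first, by dropping the boundary term of [key]; that term then tends to 0, being
   the general term of a convergent series. *)
have [l hl] : exists l, sums_to 0 (fun j => 'C(j, m.+1)%:R * c ^+ j) l.
  apply: (@sums_to_bounded _ _ _
      ((1 - c)^-1 * (c * (c ^+ m / (1 - c) ^+ m.+1)))) => [|n]; first exact: t0.
  rewrite ler_pdivlMl//.
  apply: (@le_trans _ _ ((1 - c) * \sum_(0 <= j < n.+1) 'C(j, m.+1)%:R * c ^+ j)).
    rewrite ler_wpM2l ?(ltW d0)// big_nat_recr//= lerDl.
    exact: t0.
  rewrite key ler_wpM2l// lerBlDr; apply: ler_wpDr; first exact: t0.
  exact: partial_sum_le (t0 m) IH.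
have l0 := sums_to_cvg0 hl.
have h1 : (1 - c) * (\sum_(0 <= j < N.+1) 'C(j, m.+1)%:R * c ^+ j) @[N --> \oo]
    --> (1 - c) * l.
  apply: cvgM; first exact: cvg_cst.
  by have := hl; rewrite /sums_to -cvg_shiftS.
have h2 : (1 - c) * (\sum_(0 <= j < N.+1) 'C(j, m.+1)%:R * c ^+ j) @[N --> \oo]
    --> c * (c ^+ m / (1 - c) ^+ m.+1 - 0).
  under eq_fun do rewrite key.
  by apply: cvgM; [exact: cvg_cst|exact: cvgB IH l0].
have e : (1 - c) * l = c * (c ^+ m / (1 - c) ^+ m.+1 - 0).
  exact: (cvg_unique _ h1 h2).
suff -> : c ^+ m.+1 / (1 - c) ^+ m.+2 = l by [].
apply: (mulfI (lt0r_neq0 d0)); rewrite e subr0 !exprS.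
by field; rewrite ?expf_neq0 lt0r_neq0.
Unshelve. all: by end_near. Qed.

End negative_binomial.

(** * Moments of a stationary law with abstract tails [t] and transforms [b] *)

Section stationary_moments.
Context {R : realType}.
Variables (p : nat -> R) (t : nat -> nat -> R) (b T : nat -> R).
Hypotheses (p_ge0 : forall i, (0 < i)%N -> 0 <= p i) (p_sum1 : sums_to 1 p 1).
Hypotheses (t_ge0 : forall i j, (0 < i)%N -> 0 <= t i j)
  (t_le1 : forall i j, (0 < i)%N -> t i j <= 1)
  (t_0 : forall i, (0 < i)%N -> t i 0%N = 1)
  (t_ge_b : forall i j, (0 < i)%N -> b 1%N ^+ j <= t i j)
  (t_bonferroni : forall i j n, (0 < i)%N ->
     (-1) ^+ n * (\sum_(1 <= k < n.+1) (-1) ^+ k.-1 * 'C(i, k)%:R * b k ^+ j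
                  - t i j) <= 0).
Hypotheses (b1_lt1 : b 1%N < 1)
  (b_ge0 : forall k, (0 < k)%N -> 0 <= b k)
  (b_le_b1 : forall k, (0 < k)%N -> b k <= b 1%N).
(* [sums_to] unfolds to a product, whose bound set would become an implicit
   argument of these hypotheses. *)
Unset Implicit Arguments.
Hypotheses (stationary : forall j, (0 < j)%N ->
     sums_to 1 (fun i => p i * (t i j.-1 - t i j)) (p j))
  (T_def : forall j, sums_to 1 (fun i => p i * t i j) (T j)).
Set Implicit Arguments.

Local Notation b1 := (b 1%N).

Let b1_ge0 : 0 <= b1. Proof. exact: b_ge0. Qed.

(** The Bonferroni inequality with a single term is the union bound. *)
Let t_le_linear i j : (0 < i)%N -> t i j <= i%:R * b1 ^+ j.
Proof.
move=> i0; have := t_bonferroni j 1 i0.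
by rewrite big_nat1 /= bin1 expr0 expr1 mul1r mulN1r oppr_le0 subr_ge0.
Qed.

Let T_0 : T 0%N = 1.
Proof.
apply: (sums_to_unique (T_def 0) _); apply: eq_sums_to p_sum1 => i i0.
by rewrite t_0// mulr1.
Qed.

(** The stationarity series splits into two convergent ones. With [T_0] this makes [T j] the mass of
    the states above [j]. *)
Let p_diff j : (0 < j)%N -> p j = T j.-1 - T j.
Proof.
move=> j0; apply: (sums_to_unique (stationary _ j0) _).
rewrite -[- T j]mulN1r.
apply: (@eq_sums_to _ _ (fun i => p i * t i j.-1 + -1 * (p i * t i j))).
  by move=> i _; ring.
exact: sums_toD (T_def _) (sums_toZ (T_def _)).
Qed.

Let T_ge0 j : 0 <= T j.
Proof.
apply: (le_sums_to (sums_to0 1) (T_def j)) => i i0.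
by rewrite mulr_ge0 ?p_ge0 ?t_ge0.
Qed.

Let T_ge j : b1 ^+ j <= T j.
Proof.
rewrite -[leLHS]mulr1.
apply: (le_sums_to (sums_toZ (c := b1 ^+ j) p_sum1) (T_def j)) => i i0.
by rewrite mulrC ler_wpM2l ?p_ge0 ?t_ge_b.
Qed.

Let sum_binp (m N : nat) : \sum_(1 <= n < N.+1) 'C(n, m.+1)%:R * p n =
  \sum_(0 <= j < N) 'C(j, m)%:R * T j - 'C(N, m.+1)%:R * T N.
Proof.
rewrite -sum_bin_by_parts; apply: eq_big_nat => n /andP[n0 _].
by rewrite p_diff.
Qed.

Let sum_p N : \sum_(1 <= n < N.+1) p n = 1 - T N.
Proof.
elim: N => [|N IH]; first by rewrite big_geq// T_0 subrr.
by rewrite big_nat_recr//= IH p_diff//=; ring.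
Qed.

(* Under [p], the truncated mean E(min(n, N)) is the sum of the first N tails,
   and one step of the chain maps a state [i <= N] to a mean at most
   [J + i / 2]; states above N contribute at most [N] on both sides. *)
Lemma stationary_mean_finite : exists x1, sums_to 1 (fun n => n%:R * p n) x1.
Proof.
have d0 : 0 < 1 - b1 by rewrite subr_gt0.
(* [J] is such that the union bounds for [j >= J] add up to at most [i / 2]; each of the first [J]
   terms is at most 1. *)
have [J hJ] : exists J, b1 ^+ J / (1 - b1) <= 2^-1.
  have := @cvg_geometric R 1 b1; rewrite ger0_norm// => /(_ b1_lt1).
  move=> /cvgr_le/(_ ((1 - b1) / 2)) [|J _ /(_ J (leqnn _))/=].
    by rewrite divr_gt0.
  by rewrite mul1r => h; exists J; rewrite ler_pdivrMr// mulrC.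
have sum_t i N : (0 < i)%N -> \sum_(0 <= j < N) t i j <= J%:R + i%:R / 2.
  move=> i0.
  apply: (@le_trans _ _ (\sum_(0 <= j < J + N) t i j)).
    by apply: nondecreasing_partial_sum; rewrite ?leq_addl// => j _; exact: t_ge0.
  rewrite (@big_cat_nat _ _ _ J)//= ?leq_addr//; apply: lerD.
    rewrite -[J in leRHS]subn0 -sumr_const_nat.
    by apply: ler_sum_nat => j _; exact: t_le1.
  apply: (@le_trans _ _ (\sum_(J <= j < J + N) i%:R * b1 ^+ j)).
    by apply: ler_sum_nat => j _; exact: t_le_linear.
  rewrite -mulr_sumr ler_wpM2l// -{1}[J]add0n big_addn addKn.
  apply: le_trans hJ; under eq_bigr do rewrite exprD mulrC.
  rewrite -mulr_sumr ler_wpM2l ?exprn_ge0 ?b1_ge0//.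
  have b01 : 0 <= b1 < 1 by rewrite b1_ge0.
  have := negative_binomial (m := 0) b01; rewrite expr0 expr1 div1r.
  move=> /(partial_sum_le N _); under eq_bigr do rewrite bin0 mul1r.
  by apply=> j _; rewrite mulr_ge0// exprn_ge0.
(* The bound [2 * J] solves [A <= J + A / 2] for the truncated first moment [A], a finite sum. *)
apply: (@sums_to_bounded _ _ _ (2 * J%:R)) => [n n0|].
  by rewrite mulr_ge0 ?p_ge0.
case=> [|N]; first by rewrite big_geq// mulr_ge0.
set A := \sum_(1 <= n < N.+1) _.
have AE : A = \sum_(0 <= j < N) T j - N%:R * T N.
  rewrite -[N in N%:R](bin1 N).
  transitivity (\sum_(1 <= n < N.+1) 'C(n, 1)%:R * p n).
    by apply: eq_bigr => n _; rewrite bin1.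
  by rewrite sum_binp; congr (_ - _); apply: eq_bigr => j _; rewrite bin0 mul1r.
suff : \sum_(0 <= j < N) T j <= J%:R + A / 2 + N%:R * T N by rewrite AE; lra.
have TN : sums_to 1 (fun i => \sum_(0 <= j < N) p i * t i j)
    (\sum_(0 <= j < N) T j) by apply: sums_to_sum => j _; exact: T_def.
apply: (sums_to_le TN) => n _.
have term_ge0 i : (0 < i)%N -> 0 <= \sum_(0 <= j < N) p i * t i j.
  by move=> i0; apply: sumr_ge0 => j _; rewrite mulr_ge0 ?p_ge0 ?t_ge0.
(* The range is enlarged so that it can always be split at [N.+1]. *)
apply: (@le_trans _ _
    (\sum_(1 <= i < N.+1 + n) \sum_(0 <= j < N) p i * t i j)).
  by apply: nondecreasing_partial_sum; rewrite ?leq_addl.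
rewrite (@big_cat_nat _ _ _ N.+1)//= ?leq_addr//; apply: lerD.
  apply: (@le_trans _ _ (\sum_(1 <= i < N.+1) (J%:R * p i + 2^-1 * (i%:R * p i)))).
    apply: ler_sum_nat => i /andP[i0 _]; rewrite -mulr_sumr.
    apply: le_trans (ler_wpM2l (p_ge0 i0) (sum_t i N i0)) _.
    by rewrite le_eqVlt; apply/orP; left; apply/eqP; ring.
  rewrite big_split/= -!mulr_sumr -/A sum_p.
  have : J%:R * T N >= 0 by rewrite mulr_ge0.
  lra.
(* For states above [N], bounding [t] by 1 leaves [N] times their mass, which is at most [T N]. *)
apply: (@le_trans _ _ (\sum_(N.+1 <= i < N.+1 + n) N%:R * p i)).
  apply: ler_sum_nat => i /andP[Ni _].
  have i0 : (0 < i)%N by exact: leq_trans Ni.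
  rewrite -mulr_sumr mulrC ler_wpM2r ?p_ge0//.
  apply: le_trans (ler_sum_nat _) _; first by move=> j _; exact: t_le1.
  by rewrite sumr_const_nat subn0.
rewrite -mulr_sumr ler_wpM2l//.
have := partial_sum_le (N.+1 + n) p_ge0 p_sum1.
by rewrite (@big_cat_nat _ _ _ N.+1)//= ?leq_addr// sum_p; lra.
Qed.

(** Averaging the union bound over [p] replaces the factor [i] by the finite mean. *)
Let T_le : exists2 x1, 0 <= x1 & forall j, T j <= x1 * b1 ^+ j.
Proof.
have [x1 hx1] := stationary_mean_finite; exists x1.
  apply: (le_sums_to (sums_to0 1) hx1) => i i0.
  by rewrite mulr_ge0 ?p_ge0.
move=> j; rewrite mulrC.
apply: (le_sums_to (T_def j) (sums_toZ (c := b1 ^+ j) hx1)) => i i0.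
rewrite mulrA mulrC ler_wpM2r ?p_ge0// mulrC.
exact: t_le_linear.
Qed.

(** This is $x_m$, because the falling factorial is $m!$ times the binomial coefficient. As a bare
    limit it says nothing about convergence, which is shown below for positive [m]. *)
Definition binomial_moment m := limn (fun n => \sum_(1 <= i < n) 'C(i, m)%:R * p i).

Local Notation X := binomial_moment.

Let b01 : 0 <= b1 < 1. Proof. by rewrite b1_ge0. Qed.

(** The first series converges by the geometric decay of [T]. The second has the same sum, because
    the boundary term is at most [x1 * ('C(n, m.+1) * b1 ^+ n)], which tends to 0. *)
Let sums_to_tail m : sums_to 0 (fun j => 'C(j, m)%:R * T j) (X m.+1) /\
  sums_to 1 (fun n => 'C(n, m.+1)%:R * p n) (X m.+1).
Proof.
have [x1 x10 Tx1] := T_le.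
have term_ge0 k c j : 0 <= c j -> 0 <= 'C(j, k)%:R * c j :> R.
  by move=> c0; rewrite mulr_ge0.
have [l hl] : exists l, sums_to 0 (fun j => 'C(j, m)%:R * T j) l.
  apply: (@sums_to_bounded _ _ _ (x1 * (b1 ^+ m / (1 - b1) ^+ m.+1))) => [j _|n].
    by rewrite mulr_ge0.
  apply: (@le_trans _ _ (x1 * \sum_(0 <= j < n) 'C(j, m)%:R * b1 ^+ j)).
    rewrite mulr_sumr; apply: ler_sum_nat => j _.
    by rewrite mulrCA ler_wpM2l.
  rewrite ler_wpM2l//; apply: partial_sum_le (negative_binomial b01).
  by move=> j _; rewrite mulr_ge0// exprn_ge0.
have l' : sums_to 1 (fun n => 'C(n, m.+1)%:R * p n) l.
  rewrite /sums_to -cvg_shiftS/=.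
  under eq_fun do rewrite sum_binp.
  rewrite -[l]subr0; apply: cvgB => //.
  apply: (@squeeze_cvgr _ _ _ _ (fun=> 0)
      (fun n => x1 * ('C(n, m.+1)%:R * b1 ^+ n))) => //.
  - by near=> n; rewrite mulr_ge0//= mulrCA ler_wpM2l.
  - exact: cvg_cst.
  - rewrite -[X in _ --> X](mulr0 x1); apply: cvgM; first exact: cvg_cst.
    exact: sums_to_cvg0 (negative_binomial b01).
have -> : X m.+1 = l by exact: (cvg_lim _ l').
by [].
Unshelve. all: by end_near. Qed.

Lemma sums_to_binomial_moment m : (0 < m)%N ->
  sums_to 1 (fun n => 'C(n, m)%:R * p n) (X m).
Proof. by case: m => // m _; have [] := sums_to_tail m. Qed.

Let X_ge0 m : (0 < m)%N -> 0 <= X m.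
Proof.
move=> m0; apply: (le_sums_to (sums_to0 1) (sums_to_binomial_moment m0)) => i i0.
by rewrite mulr_ge0 ?p_ge0.
Qed.

(** The lower bound on the tails, summed with binomial weights; it is what forces divergence when
    [b1] is at least 1/2. *)
Let X_ge m : b1 ^+ m / (1 - b1) ^+ m.+1 <= X m.+1.
Proof.
have [h _] := sums_to_tail m.
apply: (le_sums_to (negative_binomial b01) h) => j _.
by rewrite ler_wpM2l.
Qed.

Let X_le : exists2 x1, 0 <= x1 &
  forall m, X m.+1 <= x1 * (b1 ^+ m / (1 - b1) ^+ m.+1).
Proof.
have [x1 x10 Tx1] := T_le; exists x1 => // m; have [h _] := sums_to_tail m.
apply: (le_sums_to h (sums_toZ (c := x1) (negative_binomial b01))) => j _.
by rewrite mulrCA ler_wpM2l.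
Qed.

Definition system_sum m n : R := \sum_(1 <= k < n.+1)
  X k * (-1) ^+ k.-1 * (b k ^+ m.-1 / (1 - b k) ^+ m).

(** Averaging over the state [i] turns ['C(i, k)] into [X k]. Only finitely many [k] occur, so no
    two infinite sums are interchanged. *)
Let T_bonferroni n j :
  (-1) ^+ n * (\sum_(1 <= k < n.+1) (-1) ^+ k.-1 * b k ^+ j * X k - T j) <= 0.
Proof.
have h : sums_to 1
    (fun i => \sum_(1 <= k < n.+1) (-1) ^+ k.-1 * b k ^+ j * ('C(i, k)%:R * p i))
    (\sum_(1 <= k < n.+1) (-1) ^+ k.-1 * b k ^+ j * X k).
  apply: sums_to_sum => k; rewrite mem_index_iota => /andP[k0 _].
  exact/sums_toZ/sums_to_binomial_moment.
have := sums_toZ (c := (-1) ^+ n) (sums_toD h (sums_toZ (c := -1) (T_def j))).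
rewrite mulN1r => h'; apply: (le_sums_to h' (sums_to0 1)) => i i0.
rewrite (_ : _ + _ = p i * (\sum_(1 <= k < n.+1)
    (-1) ^+ k.-1 * 'C(i, k)%:R * b k ^+ j - t i j)); last first.
  rewrite mulrBr mulr_sumr mulN1r; congr (_ - _).
  by apply: eq_bigr => k _; ring.
by rewrite mulrCA mulr_ge0_le0 ?p_ge0 ?t_bonferroni.
Qed.

(* Bonferroni's inequalities survive both summations, so the partial sums
   alternate around the moment. *)
Let system_sum_alternates m n :
  (-1) ^+ n * (system_sum m.+1 n - X m.+1) <= 0.
Proof.
have h : sums_to 0
    (fun j => \sum_(1 <= k < n.+1) X k * (-1) ^+ k.-1 * ('C(j, m)%:R * b k ^+ j))
    (system_sum m.+1 n).
  apply: sums_to_sum => k; rewrite mem_index_iota => /andP[k0 _].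
  apply/sums_toZ/negative_binomial.
  by rewrite b_ge0// (le_lt_trans (b_le_b1 k0)).
have [hX _] := sums_to_tail m.
have := sums_toZ (c := (-1) ^+ n) (sums_toD h (sums_toZ (c := -1) hX)).
rewrite mulN1r => h'; apply: (le_sums_to h' (sums_to0 0)) => j _.
rewrite (_ : _ + _ = 'C(j, m)%:R * (\sum_(1 <= k < n.+1)
    (-1) ^+ k.-1 * b k ^+ j * X k - T j)); last first.
  rewrite mulrBr mulr_sumr mulN1r; congr (_ - _).
  by apply: eq_bigr => k _; ring.
by rewrite mulrCA mulr_ge0_le0// T_bonferroni.
Qed.

(** Odd partial sums are at least [X m] and even ones at most [X m], so a limit can lie strictly on
    neither side. *)
Lemma cvg_system_sum m : (0 < m)%N -> cvgn (system_sum m) ->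
  system_sum m n @[n --> \oo] --> X m.
Proof.
case: m => // m _ /cvg_ex[/= L hL].
suff -> : X m.+1 = L by [].
apply/eqP; rewrite eq_le; apply/andP; split; rewrite leNgt; apply/negP => lt.
- have [N _ /(_ N.*2.+1)/=] := cvgr_lt _ hL _ lt.
  have := system_sum_alternates m N.*2.+1.
  rewrite -signr_odd/= odd_double/= expr1 mulN1r oppr_le0 subr_ge0 => h /(_ _).
  have N2 : (N <= N.*2.+1)%N by rewrite -addnn leqW// leq_addr.
  by move=> /(_ N2); rewrite ltNge h.
- have [N _ /(_ N.*2)/=] := cvgr_gt _ hL _ lt.
  have := system_sum_alternates m N.*2.
  rewrite -signr_odd/= odd_double/= expr0 mul1r subr_le0 => h.
  have N2 : (N <= N.*2)%N by rewrite -addnn leq_addr.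
  by move=> /(_ N2); rewrite ltNge h.
Qed.

(** If [b1 >= 1/2], every term for [m = 1] has absolute value at least 1, by [X_ge]. If [b1 < 1/2],
    [X_le] gives for every [m] a geometric majorant of ratio [b1 / (1 - b1)]. *)
Lemma cvg_system_sumP :
  (forall m, (0 < m)%N -> cvgn (system_sum m)) <-> b1 < 2^-1.
Proof.
have d0 : 0 < 1 - b1 by rewrite subr_gt0.
have dk k : (0 < k)%N -> 0 < 1 - b1 <= 1 - b k.
  by move=> k0; rewrite d0 lerB ?b_le_b1.
pose u m k := X k * (-1) ^+ k.-1 * (b k ^+ m.-1 / (1 - b k) ^+ m).
have norm_u m k : (0 < k)%N -> `|u m k| = X k * (b k ^+ m.-1 / (1 - b k) ^+ m).
  move=> k0; have /andP[_ dbk] := dk k k0.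
  have a0 : 0 <= b k ^+ m.-1 / (1 - b k) ^+ m.
    by rewrite divr_ge0 ?exprn_ge0 ?b_ge0// (le_trans (ltW d0)).
  by rewrite /u normrM (ger0_norm a0) normrM normr_sign mulr1 ger0_norm ?X_ge0.
split=> [/(_ 1%N isT)/cvg_ex[/= l hl]|b_lt m m0].
  have hu : sums_to 1 (u 1%N) l by rewrite /sums_to -cvg_shiftS.
  rewrite ltNge; apply/negP => b_ge.
  have /cvgr0_norm_lt/(_ _ ltr01)[N _ /(_ N.+1 (leqnSn N))/=] := sums_to_cvg0 hu.
  rewrite norm_u// ltNge => /negP; apply.
  have /andP[_ dbk] := dk N.+1 isT.
  rewrite expr0 expr1 div1r -[leLHS]mulr1 ler_pM//.
    apply: le_trans (X_ge N); rewrite exprS invfM mulrCA -exprVn -exprMn.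
    rewrite -[leLHS]mulr1 ler_pM//.
      by rewrite invf_ge1// gerBl.
    by rewrite exprn_ege1// ler_pdivlMr// mul1r; lra.
  by rewrite invf_ge1 ?(lt_le_trans d0)// gerBl b_ge0.
have [x1 x10 Xx1] := X_le.
have -> : system_sum m = series (fun k => u m k.+1).
  by apply/funext => n; rewrite /system_sum /series/= big_add1.
apply: normed_cvg.
(* The factor [x1 / (1 - b1)] comes from [X_le]; the other bounds the coefficients, since
   [b k <= b1 < 1]. *)
pose C := x1 / (1 - b1) / (1 - b1) ^+ m.
apply: (@series_le_cvg _ _ (geometric C (b1 / (1 - b1)))) => [n|n|n|].
- exact: normr_ge0.
- by rewrite /= mulr_ge0 ?exprn_ge0 ?divr_ge0 ?exprn_ge0// ltW.
- have /andP[_ dbk] := dk n.+1 isT; have dn0 := lt_le_trans d0 dbk.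
  rewrite /= norm_u// (_ : C * _ =
      x1 * (b1 ^+ n / (1 - b1) ^+ n.+1) * (1 / (1 - b1) ^+ m)).
    rewrite ler_pM ?X_ge0//; first by rewrite divr_ge0 ?exprn_ge0 ?b_ge0 ?(ltW dn0).
    rewrite ler_pM ?invr_ge0 ?exprn_ge0 ?b_ge0 ?(ltW dn0)//.
      rewrite exprn_ile1 ?b_ge0//.
      by apply: le_trans (ltW b1_lt1); exact: b_le_b1.
    rewrite lef_pV2 ?posrE ?exprn_gt0// lerXn2r ?nnegrE
      ?(ltW d0) ?(ltW dn0)//.
  by rewrite /C expr_div_n exprS; field; rewrite ?expf_neq0 lt0r_neq0.
- apply: is_cvg_geometric_series.
  rewrite ger0_norm ?divr_ge0 ?(ltW d0)// ltr_pdivrMr// mul1r; lra.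
Qed.

End stationary_moments.

(** * Joint laws and the tail of a difference *)

Section independence.
Context {R : realType} {d : measure_display} {T : measurableType d}
  {P : probability T R}.
Implicit Types Y Z W : {RV P >-> R}.

(** Uniqueness of the product measure, applied to the law of the pair under [P] restricted to [G]
    and divided by [P G]; a null [G] is treated apart. Carrying [G] along preserves independence
    from the remaining variables. *)
Lemma joint_law Y Z (G : set T) (mG : measurable G) :
  (forall A B : set R, measurable A -> measurable B ->
     P (Y @^-1` A `&` (Z @^-1` B `&` G)) =
     (P (Y @^-1` A) * (P (Z @^-1` B) * P G))%E) ->
  forall C : set (R * R), measurable C ->
    P ((fun w => (Y w, Z w)) @^-1` C `&` G) =
    ((distribution P Y \x distribution P Z) C * P G)%E.
Proof.
move=> indYZ C mC.
have mYZ : measurable_fun [set: T] (fun w => (Y w, Z w)).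
  by apply: measurable_fun_pair; exact: measurable_funPT.
have mpre (D : set (R * R)) : measurable D ->
    measurable ((fun w => (Y w, Z w)) @^-1` D).
  by move=> mD; rewrite -[X in measurable X]setTI; exact: mYZ.
have [PG0|PG0] := eqVneq (P G) 0%E.
  rewrite PG0 mule0; apply/eqP; rewrite -measure_le0 -PG0.
  by apply: le_measure; rewrite ?inE//; apply: measurableI => //; exact: mpre.
have PGfin : P G \is a fin_num by exact: fin_num_measure.
pose c := fine (P G).
have c0 : 0 < c by rewrite fine_gt0// lt0e PG0 measure_ge0 ltey_eq PGfin.
have ci0 : 0 <= c^-1 by rewrite invr_ge0 ltW.
pose m := mscale (NngNum ci0) (pushforward (mrestr P mG) (fun w => (Y w, Z w))).
have mE D : m mYZ D =
  ((c^-1)%:E * P ((fun w => (Y w, Z w)) @^-1` D `&` G))%E by [].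
have cP x : ((c^-1)%:E * (x * P G) = x)%E.
  rewrite muleC -muleA -(fineK PGfin) -EFinM mulfV ?mule1//.
  by rewrite lt0r_neq0.
have -> : (distribution P Y \x distribution P Z)%E C = m mYZ C.
  apply: product_measure_unique => // A B mA mB.
  transitivity (m mYZ (A `*` B)); first by [].
  rewrite mE -[RHS]cP; congr (_ * _)%E.
  by rewrite -muleA -indYZ// setIA.
rewrite mE muleC muleA -(fineK PGfin) -EFinM mulfV ?mul1e//.
by rewrite lt0r_neq0.
Qed.

Definition tail Y (t : R) : R := fine (P [set w | t < Y w]).

Let measurable_gt Y (t : R) : measurable [set w | t < Y w].
Proof.
have -> : [set w | t < Y w] = Y @^-1` `]t, +oo[%classic.
  by apply/seteqP; split => w /=; rewrite in_itv/= andbT.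
exact: measurable_funPTI.
Qed.

Lemma tailE Y t : (tail Y t)%:E = P [set w | t < Y w].
Proof. by rewrite fineK// fin_num_measure. Qed.

Lemma prob_le_tail Y t : P (Y @^-1` `]-oo, t]%classic) = (1 - tail Y t)%:E.
Proof.
rewrite EFinB tailE -probability_setC//; congr (P _).
by apply/seteqP; split => w /=; rewrite in_itv/= leNgt => /negP.
Qed.

Lemma tail_ge0 Y t : 0 <= tail Y t.
Proof. by rewrite -lee_fin tailE. Qed.

Lemma tail_le1 Y t : tail Y t <= 1.
Proof. by rewrite -lee_fin tailE probability_le1. Qed.

Lemma tail_nonincreasing Y : {homo tail Y : s t /~ s <= t}.
Proof.
move=> s t st; rewrite -lee_fin !tailE; apply: le_measure; rewrite ?inE//.
by move=> w /=; exact: le_lt_trans.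
Qed.

(** Conditioning on [Z], by Fubini for the product of the two laws. *)
Lemma tail_sub Y Z W (B : probability (measurableTypeR R) R) (t : R) :
  (forall A B : set R, measurable A -> measurable B ->
     P (Y @^-1` A `&` Z @^-1` B) = (P (Y @^-1` A) * P (Z @^-1` B))%E) ->
  (forall A : set R, measurable A -> distribution P Z A = B A) ->
  B `]-oo, 0[%classic = 0%E ->
  (forall w, W w = Y w - Z w) ->
  tail W t = \int[B]_(y in `[0, +oo[) tail Y (t + y).
Proof.
move=> indYZ lawZ B0 WE.
pose C := [set yz : R * R | t < yz.1 - yz.2].
have mC : measurable C.
  have -> : C = (fun yz : R * R => yz.1 - yz.2) @^-1` `]t, +oo[%classic.
    by apply/seteqP; split => w /=; rewrite /C/= in_itv/= andbT.
  rewrite -[X in measurable X]setTI.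
  have mf : measurable_fun [set: R * R] (fun yz : R * R => yz.1 - yz.2).
    exact: measurable_funB.
  by apply: mf => //; exact: measurable_itv.
have := joint_law measurableT _ mC.
move=> /(_ Y Z); rewrite probability_setT mule1 setIT => joint.
have mtail : measurable_fun [set: R] (fun y => tail Y (t + y)).
  apply: nonincreasing_measurable => // x y xy.
  by apply: tail_nonincreasing; rewrite lerD2l.
rewrite /Rintegral /tail; congr fine.
(* The negative half-line is null for [B], so the integral may run over the whole line. *)
transitivity (\int[B]_y (tail Y (t + y))%:E)%E; last first.
  rewrite (@ge0_negligible_integral _ _ R B setT (`]-oo, 0[%classic : set R))//.
  - congr (integral _ _ _); apply/seteqP; split => y /=; rewrite !in_itv/= ?andbT.
      by move=> [_ /negP]; rewrite -leNgt.
    by move=> y0; split=> //; apply/negP; rewrite -leNgt.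
  - exact/measurable_EFinP.
  - by move=> y _; rewrite lee_fin tail_ge0.
transitivity (\int[distribution P Z]_y (tail Y (t + y))%:E)%E; last first.
  rewrite ge0_integral_distribution; first last.
  - by move=> y; rewrite lee_fin tail_ge0.
  - exact/measurable_EFinP.
  pose Z' : T -> measurableTypeR R := Z.
  have mZ : measurable_fun [set: T] Z' by exact: (measurable_funPT Z).
  have := @ge0_integral_pushforward _ _ _ (measurableTypeR R) R Z' mZ P setT
    (fun y => (tail Y (t + y))%:E) measurableT.
  rewrite preimage_setT => <-.
  - apply: eq_measure_integral => A mA _; exact: lawZ.
  - exact/measurable_EFinP.
  - by move=> y _; rewrite lee_fin tail_ge0.
transitivity (P ((fun w => (Y w, Z w)) @^-1` C)).
  by congr (P _); apply/seteqP; split => w /=; rewrite WE.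
rewrite joint; last first.
  by move=> A A' mA mA'; rewrite setIT mule1 indYZ.
(* The other order of integration, in which the law of [Z] is outermost; both products agree on
   rectangles. *)
transitivity ((distribution P Y \x^ distribution P Z) C)%E.
  by apply: product_measure_unique => //= A A' mA mA'; rewrite product_measure2E.
apply: eq_integral => y _ /=; rewrite tailE /distribution /pushforward.
congr (P _); apply/seteqP; split => w /=; rewrite ysectionE /C/= ltrBrDr//.
Qed.

End independence.

(** * Independence when members of a family are absorbed one by one *)

Section independence_of_family.
Context {R : realType} {d : measure_display} {T : measurableType d}
  {P : probability T R} {I : eqType} (X : I -> {RV P >-> R}).
Hypothesis indX : mutually_independent X.
Implicit Types (Y : {RV P >-> R}) (D : pred I).

Let event (s : seq I) (E : I -> set R) := \bigcap_(i in [set` s]) X i @^-1` E i.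

Let measurable_event s E : (forall i, measurable (E i)) -> measurable (event s E).
Proof.
move=> mE; apply: fin_bigcap_measurable => // i _; exact: measurable_funPTI.
Qed.

Let event_cons i s E : event (i :: s) E = X i @^-1` E i `&` event s E.
Proof.
apply/seteqP; split => [w h|w [hi hs] j /=].
  split; first by apply: h; rewrite /= mem_head.
  by move=> j js; apply: h; rewrite /= in_cons [_ \in _]js orbT.
by rewrite in_cons => /predU1P[->//|js]; exact: hs.
Qed.

(** With this, a constraint on a new index [i] merges with an event over [s] into a single event
    over [i :: s]. *)
Let event_update (i : I) s E (A : set R) : i \notin s ->
  event s (fun j => if j == i then A else E j) = event s E.
Proof.
move=> si; rewrite /event; apply: eq_bigcapr => j /= js.
by case: eqP => // ji; rewrite -ji js in si.
Qed.

(** Stated on finite joint events of the members indexed in [D], the form that an induction can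
    maintain while [Y] absorbs members. *)
Definition independent_of Y D := forall s E (A : set R), uniq s -> all D s ->
  (forall i, measurable (E i)) -> measurable A ->
  P (Y @^-1` A `&` event s E) = (P (Y @^-1` A) * P (event s E))%E.

Lemma sub_independent_of Y D D' : {subset D' <= D} ->
  independent_of Y D -> independent_of Y D'.
Proof.
move=> D'D indY s E A us /allP D's mE mA; apply: indY => //.
by apply/allP => i /D's /D'D.
Qed.

Lemma independent_of_self i : independent_of (X i) (predC1 i).
Proof.
move=> s E A us /allP Ds mE mA.
have si : i \notin s by apply/negP => /Ds/=; rewrite eqxx.
rewrite -(event_update _ A si).
set E' := fun j => _.
have mE' j : measurable (E' j) by rewrite /E'; case: ifP.
have {1 2}-> : A = E' i by rewrite /E' eqxx.
rewrite -event_cons [in LHS]/event indX//=; last by rewrite si.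
by rewrite big_cons -indX.
Qed.

Lemma independent_pair Y D i (A B : set R) : independent_of Y D -> D i ->
  measurable A -> measurable B ->
  P (Y @^-1` A `&` X i @^-1` B) = (P (Y @^-1` A) * P (X i @^-1` B))%E.
Proof.
move=> indY Di mA mB; have := indY [:: i] (fun=> B) A isT.
by rewrite /event set_cons1 bigcap_set1/= Di; exact.
Qed.

(** Absorbing [X i] costs only the index [i]: [Y], [X i] and any event in the remaining indices
    factorize, so [joint_law] applies. *)
Lemma independent_of_comp Y Y' D i (f : R * R -> R) :
  measurable_fun [set: R * R] f -> independent_of Y D -> D i ->
  (forall w, Y' w = f (Y w, X i w)) ->
  independent_of Y' [pred j | D j && (j != i)].
Proof.
move=> mf indY Di Y'E s E A us /allP Ds mE mA.
have si : i \notin s by apply/negP => /Ds/=; rewrite eqxx andbF.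
have mfA : measurable (f @^-1` A).
  by rewrite -[X in measurable X]setTI; exact: mf.
have Y'A : Y' @^-1` A = (fun w => (Y w, X i w)) @^-1` (f @^-1` A).
  by apply/seteqP; split => w /=; rewrite Y'E.
have joint G : measurable G -> (forall A B, measurable A -> measurable B ->
     P (Y @^-1` A `&` (X i @^-1` B `&` G)) =
     (P (Y @^-1` A) * (P (X i @^-1` B) * P G))%E) ->
   P (Y' @^-1` A `&` G) =
    ((distribution P Y \x distribution P (X i)) (f @^-1` A) * P G)%E.
  by move=> mG h; rewrite Y'A; exact: joint_law.
rewrite joint.
(* The whole space as [G] identifies the product-measure factor. *)
- congr (_ * _)%E; rewrite -[Y' @^-1` A]setIT joint ?probability_setT ?mule1//.
  by move=> A1 B1 mA1 mB1; rewrite setIT mule1 (independent_pair indY Di).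
- exact: measurable_event.
- move=> A1 B1 mA1 mB1.
  rewrite -(event_update _ B1 si).
  set E' := fun j => _.
  have mE' j : measurable (E' j) by rewrite /E'; case: ifP.
  have {1 2}-> : B1 = E' i by rewrite /E' eqxx.
  rewrite -event_cons indY//=; last by rewrite Di; apply/allP => j /Ds/andP[].
    congr (_ * _)%E; rewrite event_cons; apply: independent_of_self => //.
    by apply/allP => j /Ds /andP[].
  by rewrite si.
Qed.

End independence_of_family.

(** * Bonferroni's inequalities for powers, the exponential law, Laplace transforms *)

Section transforms.
Context {R : realType}.

(** Induction on [i]: by Pascal's rule the signed error for [i.+1] at level [n.+1] is the one for
    [i] at [n.+1] plus [u] times the one for [i] at [n]. *)
Lemma bonferroni_expr (u : R) (i n : nat) : 0 <= u <= 1 ->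
  0 <= (-1) ^+ n * (\sum_(0 <= k < n.+1) (-1) ^+ k * 'C(i, k)%:R * u ^+ k
                    - (1 - u) ^+ i).
Proof.
move=> /andP[u0 u1]; elim: i n => [|i IH] n.
  rewrite expr0 big_ltn// bin0 !mul1r big_nat big1 ?addr0 ?subrr ?mulr0//.
  by move=> -[//|k] _; rewrite bin0n mulr0 mul0r.
case: n => [|n].
  rewrite big_nat1 bin0 !mul1r subr_ge0 exprn_ile1// ?subr_ge0//.
  by rewrite gerBl.
rewrite (_ : _ * _ = (-1) ^+ n.+1 *
      (\sum_(0 <= k < n.+2) (-1) ^+ k * 'C(i, k)%:R * u ^+ k - (1 - u) ^+ i)
    + u * ((-1) ^+ n *
      (\sum_(0 <= k < n.+1) (-1) ^+ k * 'C(i, k)%:R * u ^+ k - (1 - u) ^+ i))).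
  by rewrite addr_ge0// mulr_ge0.
suff -> : \sum_(0 <= k < n.+2) (-1) ^+ k * 'C(i.+1, k)%:R * u ^+ k =
    \sum_(0 <= k < n.+2) (-1) ^+ k * 'C(i, k)%:R * u ^+ k -
    u * \sum_(0 <= k < n.+1) (-1) ^+ k * 'C(i, k)%:R * u ^+ k.
  by rewrite !exprS; ring.
rewrite big_ltn// [in RHS]big_ltn// !bin0 -addrA; congr (_ + _).
rewrite !big_add1/= mulr_sumr -sumrB; apply: eq_bigr => k _.
by rewrite binS natrD !exprS; ring.
Qed.

(** The density vanishes on the negative half-line, which reduces the claim to the interval from 0
    to [t], a single point when [t = 0]. *)
Lemma exponential_prob_Nyc (mu t : R) : 0 <= t ->
  exponential_prob mu `]-oo, t]%classic = (1 - expR (- mu * t))%:E.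
Proof.
move=> t0; have -> : exponential_prob mu `]-oo, t]%classic =
    exponential_prob mu `[0, t]%classic.
  pose g x := (mu * expR (- mu * x))%:E.
  have pdfE A : exponential_prob mu A =
      (\int[lebesgue_measure]_(x in A) (g \_ `[0%R, +oo[%classic) x)%E.
    apply: eq_integral => x _; rewrite /exponential_pdf !patchE.
    by case: ifP.
  rewrite !pdfE.
  rewrite -!integral_mkcondr; congr (integral _ _ _); apply/seteqP.
  split => x /=; rewrite !in_itv/= ?andbT.
    by move=> [-> ->].
  by move=> [/andP[-> ->] _].
move: t0; rewrite le_eqVlt => /predU1P[<-|t0].
  by rewrite mulr0 expR0 subrr set_itv1 /exponential_prob integral_set1.
by rewrite exponential_prob_itv0c// EFinB.
Qed.

Variable B : probability (measurableTypeR R) R.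
Local Notation D := (`[0, +oo[%classic : set (measurableTypeR R)).
Local Notation L := (laplace_stieltjes B).

Let mD : measurable D. Proof. exact: measurable_itv. Qed.

Lemma integrable_bounded (f : R -> R) (M : R) : measurable_fun [set: R] f ->
  (forall x, 0 <= x -> `|f x| <= M) -> B.-integrable D (EFin \o f).
Proof.
move=> mf fM; apply: measurable_bounded_integrable => //.
- by rewrite (le_lt_trans (probability_le1 _ _))// ltry.
- exact: measurable_funTS.
- exists M; split; first exact: num_real.
  move=> M' MM' x /=; rewrite in_itv/= andbT => x0.
  exact: le_trans (fM _ x0) (ltW MM').
Qed.

Lemma integrable_expR (s : R) : 0 <= s ->
  B.-integrable D (EFin \o (fun y => expR (- s * y))).
Proof.
move=> s0; apply: (@integrable_bounded _ 1).
  by apply: measurableT_comp => //; exact: mulrl_measurable.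
move=> x x0; rewrite ger0_norm ?expR_ge0// -expR0 ler_expR.
by rewrite mulNr oppr_le0 mulr_ge0.
Qed.

Lemma Rintegral_sum (s : seq nat) (f : nat -> R -> R) :
  (forall k, B.-integrable D (EFin \o f k)) ->
  B.-integrable D (EFin \o (fun y => \sum_(k <- s) f k y)) /\
  \int[B]_(y in D) (\sum_(k <- s) f k y) = \sum_(k <- s) \int[B]_(y in D) f k y.
Proof.
move=> fi; elim: s => [|k s [IHi IH]].
  rewrite (_ : (fun y => \sum_(k <- [::]) f k y) = fun=> 0); last first.
    by apply/funext => y; rewrite big_nil.
  split; first by apply: (@integrable_bounded _ 0) => // x _; rewrite normr0.
  by rewrite big_nil /Rintegral integral0.
rewrite (_ : (fun y => \sum_(j <- k :: s) f j y) =
    fun y => f k y + \sum_(j <- s) f j y); last first.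
  by apply/funext => y; rewrite big_cons.
split.
  have -> : EFin \o (fun y => f k y + \sum_(j <- s) f j y) =
    ((EFin \o f k) \+ (EFin \o (fun y => (\sum_(j <- s) f j y)%R)))%E by [].
  exact: integrableD.
by rewrite RintegralD// IH big_cons.
Qed.

Lemma laplace_ge0 s : 0 <= L s.
Proof. by apply: Rintegral_ge0 => x _; exact: expR_ge0. Qed.

Lemma laplace_nonincreasing s s' : 0 <= s -> s <= s' -> L s' <= L s.
Proof.
move=> s0 ss'; apply: le_Rintegral => //.
- by apply: integrable_expR; exact: le_trans ss'.
- exact: integrable_expR.
- move=> x /=; rewrite in_itv/= andbT => x0.
  by rewrite ler_expR ler_wpM2r// lerN2.
Qed.

(** Otherwise $1-e^{-sx}$ has integral 0 over the nonnegative half-line and vanishes there almost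
    everywhere. It is positive for $x>0$, so [B] would be the zero measure. *)
Lemma laplace_lt1 s : 0 < s -> B `]-oo, 0]%classic = 0%E -> L s < 1.
Proof.
move=> s0 B0; rewrite ltNge; apply/negP => L1.
have D1 : B D = 1%E.
  have -> : D = ~` `]-oo, 0[%classic.
    by rewrite setCitvl.
  rewrite probability_setC//.
  suff -> : B `]-oo, 0[%classic = 0%E by rewrite sube0.
  apply/eqP; rewrite -measure_le0 -B0; apply: le_measure; rewrite ?inE//.
  by move=> x /=; rewrite !in_itv/= => /ltW.
pose f x := 1 - expR (- s * x).
have f0 x : 0 <= x -> 0 <= f x.
  by move=> x0; rewrite subr_ge0 -expR0 ler_expR mulNr oppr_le0 mulr_ge0// ltW.
have i1 : B.-integrable D (EFin \o (fun=> 1 : R)).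
  by apply: (@integrable_bounded _ 1) => // x _; rewrite normr1.
have i2 := integrable_expR (ltW s0).
have intf : B.-integrable D (EFin \o f) by exact: (integrableB mD i1 i2).
have mf : measurable_fun D (EFin \o f) by exact: measurable_int intf.
have Rf0 : \int[B]_(x in D) f x = 0.
  apply/eqP; rewrite eq_le; apply/andP; split.
    rewrite RintegralB// Rintegral_cst// subr_le0; apply: le_trans L1.
    by rewrite mul1r -[leRHS]/(fine 1%E) -D1.
  by apply: Rintegral_ge0 => x /=; rewrite in_itv/= andbT; exact: f0.
have If0 : (\int[B]_(x in D) `|(EFin \o f) x| = 0)%E.
  transitivity ((\int[B]_(x in D) f x)%:E); last by rewrite Rf0.
  rewrite fineK ?integrable_fin_num//.
  apply: eq_integral => x; rewrite inE/= in_itv/= andbT => x0.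
  by rewrite ger0_norm// f0.
have /(ae_eq_integral_abs B mD mf)[N [mN BN0 fN]] := If0.
have : B [set: measurableTypeR R] = 0%E.
  apply/eqP; rewrite -measure_le0.
  pose A : set (measurableTypeR R) := `]-oo, 0]%classic.
  have -> : (0 = B A + B N)%E by rewrite B0 BN0 adde0.
  apply: (@le_trans _ _ (B (A `|` N))); last first.
    apply: measureU2 => //; exact: (measurable_itv `]-oo, 0]).
  apply: le_measure; rewrite ?inE//.
    by apply: measurableU => //; exact: (measurable_itv `]-oo, 0]).
  move=> x _; have [x0|x0] := leP x 0; first by left; rewrite /A/= in_itv.
  right; apply: fN => /=; rewrite in_itv/= andbT => /(_ (ltW x0)).
  case=> /eqP; rewrite subr_eq0 -[X in X == _]expR0 => /eqP /expR_inj /eqP.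
  by rewrite eq_sym mulf_eq0 oppr_eq0 !gt_eqF.
by rewrite probability_setT => /eqP; rewrite onee_eq0.
Qed.

End transforms.

(** * Tails of the stage length at the arrival epochs *)

Section gated_tails.
Context {R : realType} {d : measure_display} {T : measurableType d}
  {P : probability T R}.
Variables (tau sigma : nat -> {RV P >-> R})
  (B : probability (measurableTypeR R) R) (mu : R).
Hypotheses (mu_gt0 : 0 < mu)
  (tau_law : forall n (A : set R), measurable A ->
     distribution P (tau n) A = B A)
  (B_pos : B `]-oo, 0]%classic = 0%E)
  (sigma_law : forall n (A : set R), measurable A ->
     distribution P (sigma n) A = exponential_prob mu A).

Let X := fun l : nat + nat => match l with inl n => tau n | inr n => sigma n end.

Hypothesis indep : mutually_independent X.

Let random_variable_of (f : T -> R) : measurable_fun [set: T] f ->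
  exists Y : {RV P >-> R}, forall w, Y w = f w.
Proof. by move=> mf; exists (mfun_Sub (mem_set mf)). Qed.

Lemma stage_lengthS i w :
  stage_length sigma i.+1 w = Num.max (stage_length sigma i w) (sigma i w).
Proof.
rewrite /stage_length; apply/le_anti/andP; split.
  apply: bigmax_le => [|[k ki] _ /=]; first by rewrite le_max bigmax_ge_id.
  rewrite le_max; move: ki; rewrite ltnS leq_eqVlt => /predU1P[->|ki].
    by rewrite lexx orbT.
  by rewrite (le_bigmax _ (fun k : 'I_i => sigma k w) (Ordinal ki)).
rewrite ge_max; apply/andP; split.
  by apply: (@le_bigmax_ord _ _ _ _ _ xpredT (fun k => sigma k w)).
exact: (le_bigmax _ (fun k : 'I_i.+1 => sigma k w) ord_max).
Qed.

Lemma stage_length1 w : stage_length sigma 1 w = sigma 0%N w.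
Proof. by rewrite stage_lengthS /stage_length big_ord0 maxxx. Qed.

(** Each absorbed service time multiplies the distribution function by one factor. Independence from
    later services carries the induction; independence from the [tau] is kept for
    [difference_rv]. *)
Let stage_rv i : exists M : {RV P >-> R},
  [/\ forall w, M w = stage_length sigma i.+1 w,
      independent_of X M
        [pred l : nat + nat | if l is inr k then (i < k)%N else true] &
      forall t, 0 <= t -> tail M t = 1 - (1 - expR (- mu * t)) ^+ i.+1].
Proof.
have sigma_le k t : 0 <= t ->
    P (sigma k @^-1` `]-oo, t]%classic) = (1 - expR (- mu * t))%:E.
  by move=> t0; rewrite -exponential_prob_Nyc// -(sigma_law k).
elim: i => [|i [M [ME indM tailM]]].
  exists (sigma 0%N); split => [w||t t0].
  - by rewrite stage_length1.
  - apply: (sub_independent_of _ (independent_of_self indep (i := inr 0%N))).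
    by move=> [k|[|k]].
  - have := prob_le_tail (sigma 0%N) t; rewrite sigma_le// => -[].
    by rewrite expr1; lra.
have [M' M'E] : exists Y : {RV P >-> R},
    forall w, Y w = Num.max (M w) (sigma i.+1 w).
  by apply: random_variable_of; exact: measurable_maxr.
exists M'; split => [w||t t0].
- by rewrite M'E stage_lengthS ME.
- apply: sub_independent_of
    (independent_of_comp (i := inr i.+1)
      (f := fun xy : R * R => Num.max xy.1 xy.2) indep _ indM _ M'E).
  + move=> [k|k]//; rewrite !inE => ik; rewrite (ltnW ik)/=.
    by apply/eqP => -[ki]; rewrite ki ltnn in ik.
  + exact: measurable_maxr.
  + exact: ltnSn.
- have : P (M' @^-1` `]-oo, t]%classic) =
      (P (M @^-1` `]-oo, t]%classic) * P (X (inr i.+1) @^-1` `]-oo, t]%classic))%E.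
    rewrite -(independent_pair indM)//=.
    + congr (P _); apply/seteqP; split => w /=; rewrite !in_itv/= M'E ge_max.
        by move/andP.
      by move=> [-> ->].
  rewrite sigma_le// !prob_le_tail tailM// -EFinM => -[tailM'].
  rewrite exprSr; set a := (1 - _) ^+ _ in tailM' *.
  lra.
Qed.

(** Induction on [j] needs every level [t >= 0], not just 0. Subtracting [tau j] averages the level
    [t + y] over [B]; since the exponentials factor, the [k]-th term gains one more transform at
    $k\mu$, and integration preserves the inequality. *)
Let difference_rv i j : exists W : {RV P >-> R},
  [/\ forall w, W w = stage_length sigma i.+1 w - arrival_epoch tau j w,
      independent_of X W
        [pred l : nat + nat | if l is inl k then (j <= k)%N else false] &
      forall n t, 0 <= t ->
      (-1) ^+ n * (\sum_(1 <= k < n.+1) (-1) ^+ k.-1 * 'C(i.+1, k)%:R *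
          laplace_stieltjes B (k%:R * mu) ^+ j * expR (- (k%:R * mu) * t)
        - tail W t) <= 0].
Proof.
elim: j => [|j [W [WE indW bonfW]]].
  have [M [ME indM tailM]] := stage_rv i.
  exists M; split => [w||n t t0].
  - by rewrite /arrival_epoch big_ord0 subr0.
  - by apply: sub_independent_of indM => -[].
  - have u01 : 0 <= expR (- mu * t) <= 1.
      by rewrite expR_ge0 -expR0 ler_expR mulNr oppr_le0 mulr_ge0// ltW.
    (* For [j = 0] take $u = e^{-\mu t}$; the term [k = 0] cancels the 1 in the tail and the
       remaining signs flip. *)
    have := bonferroni_expr i.+1 n u01.
    rewrite tailM// big_ltn// bin0 !mul1r.
    rewrite (_ : \sum_(1 <= k < n.+1) _ = - \sum_(1 <= k < n.+1)
       (-1) ^+ k.-1 * 'C(i.+1, k)%:R * laplace_stieltjes B (k%:R * mu) ^+ 0 *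
       expR (- (k%:R * mu) * t)).
      rewrite -oppr_ge0 -mulrN => /le_trans; apply.
      by rewrite le_eqVlt; apply/orP; left; apply/eqP; congr (_ * _); ring.
    rewrite -sumrN; apply: eq_big_nat => -[//|k] _ /=.
    have -> : expR (- (k.+1%:R * mu) * t) = expR (- mu * t) ^+ k.+1.
      by rewrite -expRM_natl; congr expR; ring.
    by rewrite [in LHS]exprS; ring.
have [W' W'E] : exists Y : {RV P >-> R}, forall w, Y w = W w - tau j w.
  by apply: random_variable_of; exact: measurable_funB.
exists W'; split => [w||n t t0].
- by rewrite W'E WE /arrival_epoch big_ord_recr/= opprD addrA.
- apply: sub_independent_of
    (independent_of_comp (i := inl j)
      (f := fun xy : R * R => xy.1 - xy.2) indep _ indW _ W'E).
  + move=> [k|k]//; rewrite !inE => jk; rewrite (ltnW jk)/=.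
    by apply/eqP => -[kj]; rewrite kj ltnn in jk.
  + exact: measurable_funB.
  + exact: leqnn.
have B0 : B `]-oo, 0[%classic = 0%E.
  apply/eqP; rewrite -measure_le0 -B_pos; apply: le_measure; rewrite ?inE//.
  by move=> x /=; rewrite !in_itv/= => /ltW.
rewrite (tail_sub (Z := tau j) t _ (tau_law j) B0 W'E); last first.
  by move=> A A' mA mA'; rewrite (independent_pair (i := inl j) indW)/=.
set f := fun k y => (-1) ^+ k.-1 * 'C(i.+1, k)%:R *
  laplace_stieltjes B (k%:R * mu) ^+ j * expR (- (k%:R * mu) * (t + y)).
(* The memoryless property: the dependence on [y] separates from [t]. *)
have fE k y : f k y = (-1) ^+ k.-1 * 'C(i.+1, k)%:R *
    laplace_stieltjes B (k%:R * mu) ^+ j * expR (- (k%:R * mu) * t) *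
    expR (- (k%:R * mu) * y).
  by rewrite /f mulrDr expRD mulrA.
have kmu k : 0 <= k%:R * mu by rewrite mulr_ge0// ltW.
have mD : measurable (`[0, +oo[%classic : set (measurableTypeR R)) by [].
have intf k : B.-integrable `[0, +oo[%classic (EFin \o f k).
  have /(integrableZl mD) := integrable_expR B (kmu k).
  move=> /(_ ((-1) ^+ k.-1 * 'C(i.+1, k)%:R *
    laplace_stieltjes B (k%:R * mu) ^+ j * expR (- (k%:R * mu) * t))).
  by apply: eq_integrable => // y _; rewrite /= fE EFinM.
have [intS SE] := Rintegral_sum (index_iota 1 n.+1) intf.
have intT : B.-integrable `[0, +oo[%classic (EFin \o (fun y => tail W (t + y))).
  apply: (@integrable_bounded _ _ _ 1).
    apply: nonincreasing_measurable => // x y xy.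
    by apply: tail_nonincreasing; rewrite lerD2l.
  by move=> y _; rewrite ger0_norm ?tail_ge0 ?tail_le1.
(* The error becomes one integral, whose integrand is controlled by the induction hypothesis at
   level [t + y]. *)
rewrite (_ : _ - _ = \int[B]_(y in `[0, +oo[)
   (\sum_(1 <= k < n.+1) f k y - tail W (t + y))); last first.
  rewrite RintegralB// SE; congr (_ - _); apply: eq_bigr => k _.
  under eq_Rintegral do rewrite fE.
  rewrite RintegralZl//; last exact: integrable_expR.
  by rewrite -/(laplace_stieltjes B (k%:R * mu)) exprSr; ring.
have intD : B.-integrable `[0, +oo[%classic
    (EFin \o (fun y => \sum_(1 <= k < n.+1) f k y - tail W (t + y))).
  exact: (integrableB mD intS intT).
rewrite -oppr_ge0 -mulNr -(RintegralZl _ mD intD).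
apply: Rintegral_ge0 => y /=; rewrite in_itv/= andbT => y0.
by rewrite mulNr oppr_ge0 bonfW// addr_ge0.
Qed.

Definition survival i j : R :=
  fine (P [set w | arrival_epoch tau j w < stage_length sigma i w]).

Let survivalE i j (W : {RV P >-> R}) :
  (forall w, W w = stage_length sigma i w - arrival_epoch tau j w) ->
  survival i j = tail W 0.
Proof.
move=> WE; rewrite /survival /tail; congr (fine (P _)).
by apply/seteqP; split => w /=; rewrite WE subr_gt0.
Qed.

Let measurable_survival i j : (0 < i)%N ->
  measurable [set w | arrival_epoch tau j w < stage_length sigma i w].
Proof.
case: i => // i _; have [W [WE _ _]] := difference_rv i j.
have -> : [set w | arrival_epoch tau j w < stage_length sigma i.+1 w] =
    W @^-1` `]0, +oo[%classic.
  by apply/seteqP; split => w /=; rewrite WE in_itv/= andbT subr_gt0.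
exact: measurable_funPTI.
Qed.

Let survival_fineK i j : (0 < i)%N -> (survival i j)%:E =
  P [set w | arrival_epoch tau j w < stage_length sigma i w].
Proof.
by move=> i0; rewrite fineK// fin_num_measure//; exact: measurable_survival.
Qed.

Lemma survival_ge0 i j : (0 < i)%N -> 0 <= survival i j.
Proof. by move=> i0; rewrite fine_ge0. Qed.

Lemma survival_le1 i j : (0 < i)%N -> survival i j <= 1.
Proof.
move=> i0; rewrite -lee_fin survival_fineK// probability_le1//.
exact: measurable_survival.
Qed.

Lemma survival_0 i : (0 < i)%N -> survival i 0 = 1.
Proof.
case: i => // i _; have [M [ME _ tailM]] := stage_rv i.
rewrite (survivalE (W := M)); last first.
  by move=> w; rewrite ME /arrival_epoch big_ord0 subr0.
by rewrite tailM// mulr0 expR0 subrr expr0n subr0.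
Qed.

Lemma survival_bonferroni i j n : (0 < i)%N ->
  (-1) ^+ n * (\sum_(1 <= k < n.+1) (-1) ^+ k.-1 * 'C(i, k)%:R *
     laplace_stieltjes B (k%:R * mu) ^+ j - survival i j) <= 0.
Proof.
case: i => // i _; have [W [WE _ bonfW]] := difference_rv i j.
rewrite (survivalE WE); apply: le_trans (bonfW n 0 (lexx _)).
rewrite le_eqVlt; apply/orP; left; apply/eqP; congr (_ * (_ - _)).
by apply: eq_bigr => k _; rewrite mulr0 expR0 mulr1.
Qed.

(* [i = 1] is the case of equality; more customers only lengthen the stage. *)
Lemma survival_ge_laplace i j : (0 < i)%N ->
  laplace_stieltjes B (1%:R * mu) ^+ j <= survival i j.
Proof.
move=> i0; apply: (@le_trans _ _ (survival 1 j)).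
  (* Level 2 gives the needed direction, and its second term vanishes because ['C(1, 2) = 0]. *)
  have := survival_bonferroni j 2 (ltn0Sn 0).
  rewrite big_nat_recr// big_nat1 bin1 (@bin_small 1 2)// mulr0n mulr0 mul0r/= addr0.
  by rewrite sqrrN expr1n expr0 !mul1r subr_le0.
rewrite -lee_fin !survival_fineK//; apply: le_measure; rewrite ?inE.
- exact: measurable_survival.
- exact: measurable_survival.
move=> w /= /lt_le_trans; apply; rewrite stage_length1.
exact: bigmax_ge_id.
Qed.

Hypothesis tau_pos : forall n, {ae P, forall w, 0 < tau n w}.

(** The transition event is a difference of two survival events. They are nested only up to the null
    set where [tau] fails to be positive. *)
Lemma gated_transitionE i j : (0 < i)%N -> (0 < j)%N ->
  gated_transition tau sigma i j = (survival i j.-1 - survival i j)%:E.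
Proof.
case: j => // j i0 _ /=.
rewrite EFinB !survival_fineK// /gated_transition/=.
pose S k := [set w | arrival_epoch tau k w < stage_length sigma i w].
have mS k : measurable (S k) by exact: measurable_survival.
transitivity (P (S j `\` S j.+1)).
  congr (P _); apply/seteqP; split => w /=; rewrite /S/=.
    by move=> /andP[-> le]; split => //; apply/negP; rewrite -leNgt.
  by move=> [-> /negP]; rewrite -leNgt.
rewrite measureD//; last by rewrite (le_lt_trans (probability_le1 _ _))// ltry.
congr (_ - _)%E; have [N [mN PN0 tauN]] := tau_pos j.
apply/eqP; rewrite eq_le; apply/andP; split.
  apply: le_measure; rewrite ?inE//; [exact: measurableI|exact: mS].
rewrite -[leRHS]adde0 -PN0.
apply: (@le_trans _ _ (P ((S j `&` S j.+1) `|` N))).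
  apply: le_measure; rewrite ?inE//; first exact: (mS j.+1).
    by apply: measurableU => //; exact: measurableI.
  move=> w Sw; have [tw|tw] := ltP 0 (tau j w).
    left; split => //; move: Sw; rewrite /S/= /arrival_epoch big_ord_recr/=.
    by apply: le_lt_trans; rewrite lerDl ltW.
  by right; apply: tauN => /=; apply/negP; rewrite -leNgt.
by apply: measureU2 => //; exact: measurableI.
Qed.

End gated_tails.

(** * From extended real series to real ones *)

Section eseries.
Context {R : realType}.

Lemma eseries_sums_to (u : nat -> R) (l : R) :
  (forall i, (0 < i)%N -> 0 <= u i) ->
  (\sum_(1 <= i <oo) (u i)%:E = l%:E)%E <-> sums_to 1 u l.
Proof.
move=> u0; have cvgE : cvgn (fun n => \sum_(1 <= i < n) (u i)%:E)%E.
  by apply: is_cvg_nneseries_cond => i i1 _; rewrite lee_fin u0.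
have sumE n : (\sum_(1 <= i < n) (u i)%:E)%E = (\sum_(1 <= i < n) u i)%:E.
  by rewrite sumEFin.
split=> [ul|ul].
  move: cvgE; rewrite ul => cvgE.
  have [] := (fine_cvgP (fun n => \sum_(1 <= i < n) (u i)%:E)%E l).1 cvgE.
  move=> _; rewrite /sums_to; apply: cvg_trans; apply: near_eq_cvg.
  by near=> n; rewrite /= sumE.
apply: cvg_lim => //; apply/fine_cvgP; split.
  by near=> n; rewrite sumE.
rewrite /sums_to in ul; apply: cvg_trans ul; apply: near_eq_cvg.
by near=> n; rewrite /= sumE.
Unshelve. all: by end_near. Qed.

End eseries.

(** The first claim makes [fine] in [scaled_moment] faithful. Each equation is asserted when its
    series converges, and the third claim decides when all of them do. *)
Theorem proposition8 (R : realType) (d : measure_display)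
    (T : measurableType d) (P : probability T R)
    (tau sigma : nat -> {RV P >-> R})
    (B : probability (measurableTypeR R) R) (mu : R) (pi : nat -> R)
    (hmu : 0 < mu)
    (htau_pos : forall n, {ae P, forall w, 0 < tau n w})
    (htau_law : forall n (A : set R), measurable A ->
       distribution P (tau n) A = B A)
    (htau_sq : ('E_P[fun w => (tau 0%N w ^+ 2)%R] < +oo)%E)
    (hsigma_law : forall n (A : set R), measurable A ->
       distribution P (sigma n) A = exponential_prob mu A)
    (hindep : mutually_independent
       (fun l : nat + nat =>
          match l with inl n => tau n | inr n => sigma n end))
    (hpi : is_stationary (gated_transition tau sigma) pi) :
  let x := scaled_moment pi in
  let a := system_coef B mu in
  [/\ forall m, (0 < m)%N -> (desc_factorial_moment pi m < +oo)%E,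
      forall m, (0 < m)%N -> cvgn (system_partial_sum x a m) ->
        system_partial_sum x a m n @[n --> \oo] --> x m &
      (forall m, (0 < m)%N -> cvgn (system_partial_sum x a m)) <->
        laplace_stieltjes B mu < 2^-1].
Proof.
have B_pos : B `]-oo, 0]%classic = 0%E.
  rewrite -(htau_law 0%N)// /distribution /pushforward.
  have [N [mN PN0 tauN]] := htau_pos 0%N.
  apply/eqP; rewrite -measure_le0 -PN0; apply: le_measure; rewrite ?inE//.
    exact: measurable_funPTI.
  by move=> w /=; rewrite in_itv/= leNgt => /negP h; exact: tauN.
have [p_ge0 p_sum stat] := hpi.
pose t := survival tau sigma.
pose b k := laplace_stieltjes B (k%:R * mu).
have b1E : b 1%N = laplace_stieltjes B mu by rewrite /b mul1r.
have t_ge0 i j (i0 : (0 < i)%N) : 0 <= t i j by exact: survival_ge0.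
have t_le1 i j : (0 < i)%N -> t i j <= 1.
  exact: (survival_le1 hmu htau_law B_pos hsigma_law hindep).
have t_0 i : (0 < i)%N -> t i 0%N = 1.
  exact: (survival_0 hsigma_law hindep).
have t_ge_b i j : (0 < i)%N -> b 1%N ^+ j <= t i j.
  exact: (survival_ge_laplace hmu htau_law B_pos hsigma_law hindep).
have t_bonf i j n : (0 < i)%N ->
    (-1) ^+ n * (\sum_(1 <= k < n.+1) (-1) ^+ k.-1 * 'C(i, k)%:R * b k ^+ j
                  - t i j) <= 0.
  exact: (survival_bonferroni hmu htau_law B_pos hsigma_law hindep).
have kmu k : 0 <= k%:R * mu by rewrite mulr_ge0// ltW.
have b1_lt1 : b 1%N < 1 by rewrite b1E; exact: laplace_lt1.
have b_ge0 k (_ : (0 < k)%N) : 0 <= b k by exact: laplace_ge0.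
have b_le_b1 k : (0 < k)%N -> b k <= b 1%N.
  move=> k0; apply: laplace_nonincreasing => //.
  by rewrite ler_pM2r// ler_nat.
have p_sum1 : sums_to 1 pi 1 by apply/eseries_sums_to.
have statR j : (0 < j)%N ->
    sums_to 1 (fun i => pi i * (t i j.-1 - t i j)) (pi j).
  move=> j0.
  have gtE i : (0 < i)%N -> gated_transition tau sigma i j =
      (t i j.-1 - t i j)%:E.
    by move=> i0;
      exact: (gated_transitionE hmu htau_law B_pos hsigma_law hindep htau_pos).
  apply/eseries_sums_to => [i i0|].
    rewrite mulr_ge0 ?p_ge0// -lee_fin -gtE//; exact: measure_ge0.
  rewrite -stat//; congr (limn _); apply/funext => n.
  by apply: eq_big_nat => i /andP[i0 _]; rewrite gtE.
(* The limit provides a total function of [j]; the series converges because it is dominated by that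
   of [pi]. *)
pose T' j := limn (fun n => \sum_(1 <= i < n) pi i * t i j).
have T_def j : sums_to 1 (fun i => pi i * t i j) (T' j).
  have [l hl] : exists l, sums_to 1 (fun i => pi i * t i j) l.
    apply: (@sums_to_bounded _ _ _ 1) => [i i0|n].
      by rewrite mulr_ge0 ?p_ge0 ?t_ge0.
    apply: le_trans (partial_sum_le n p_ge0 p_sum1).
    apply: ler_sum_nat => i /andP[i0 _].
    by rewrite -[leRHS]mulr1 ler_wpM2l ?p_ge0 ?t_le1.
  by have -> : T' j = l by exact: (cvg_lim _ hl).
have momE m : (0 < m)%N ->
    desc_factorial_moment pi m = (m`!%:R * binomial_moment pi m)%:E.
  move=> m0; apply/eseries_sums_to => [i i0|].
    by rewrite mulr_ge0 ?p_ge0.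
  apply: (@eq_sums_to _ _ (fun n => m`!%:R * ('C(n, m)%:R * pi n))) => [n _|].
    by rewrite mulrA -natrM mulnC bin_ffact.
  apply: sums_toZ.
  exact: (sums_to_binomial_moment p_ge0 p_sum1 t_ge0 t_le1 t_0 t_bonf b1_lt1
    b_ge0 statR T_def).
have xE m : (0 < m)%N -> scaled_moment pi m = binomial_moment pi m.
  by move=> m0; rewrite /scaled_moment momE//= mulrC mulKf.
move=> x a.
have sumE m : system_partial_sum x a m = system_sum pi b m.
  apply/funext => n; apply: eq_big_nat => k /andP[k0 _].
  by rewrite /x xE.
split=> [m m0|m m0|].
- by rewrite momE// ltry.
- rewrite sumE /x xE// => scvg.
  exact: (cvg_system_sum p_ge0 p_sum1 t_ge0 t_le1 t_0 t_bonf b1_lt1 b_ge0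
    b_le_b1 statR T_def).
- rewrite -b1E.
  have <- := (cvg_system_sumP p_ge0 p_sum1 t_ge0 t_le1 t_0 t_ge_b t_bonf b1_lt1
    b_ge0 b_le_b1 statR T_def).
  by split=> h m m0; have := h m m0; rewrite sumE.
Qed.
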